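(* Let $d \ge 1$ and $k \ge 1$ be integers, and let $G$ be a digraph with $n = |V(G)| \le kd$ in which every vertex has out-degree at least $d$. If $\alpha(G) \le (k+1)/2$, then $g(G) \le k$.
   Context: All digraphs are finite, nonempty and simple: no loops and no parallel edges, where two oppositely directed edges between the same pair of vertices also count as parallel (so there are no directed cycles of length 1 or 2). The out-degree of a vertex is its number of out-neighbors. ''Cycle'' means directed cycle. The girth $g(G)$ is the length of a shortest directed cycle of $G$ (so $g(G) \le k$ means that $G$ contains a directed cycle of length at most $k$). A set of vertices is independent if there is no edge (in either direction) between any two of its vertices; the independence number $\alpha(G)$ is the maximum size of an independent set of vertices of $G$. *)

(* Defs.v *)
From mathcomp Require Import all_boot.

Set Implicit Arguments.
Unset Strict Implicit.
Unset Printing Implicit Defensive.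

(* A digraph with vertex type V is given by its edge relation e : rel V, where
   e x y means that there is an edge from x to y; a relation has no multiple
   edges in the same direction. *)

Definition simple_digraph (V : finType) (e : rel V) : Prop :=
  irreflexive e /\ (forall x y : V, ~~ (e x y && e y x)).

Definition outdeg (V : finType) (e : rel V) (x : V) : nat := #|[set y | e x y]|.

Definition independent (V : finType) (e : rel V) (S : {set V}) : bool :=
  [forall x in S, forall y in S, ~~ e x y].

(* The maximum is over a nonempty family, since set0 is independent. *)
Definition alpha (V : finType) (e : rel V) : nat :=
  \max_(S : {set V} | independent e S) #|S|.

(* ucycleb accepts the empty sequence, which is not a directed cycle. The
   length of the cycle c is size c, as the edge from the last vertex of c to
   the first one is implicit. *)
Definition dicycle (V : finType) (e : rel V) (c : seq V) : bool :=
  (0 < size c) && ucycleb e c.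

(* The girth is a relation because it is undefined (infinite) for a digraph
   without directed cycles. *)
Definition is_girth (V : finType) (e : rel V) (g : nat) : Prop :=
  (exists2 c : seq V, dicycle e c & size c = g) /\
  (forall c : seq V, dicycle e c -> g <= size c).

Definition girth_leq (V : finType) (e : rel V) (k : nat) : Prop :=
  exists2 g : nat, is_girth e g & g <= k.

(* Main.v *)
Require Import Defs.
From mathcomp Require Import all_boot.
From mathcomp Require Import zify.

(* Give the vertices positive weights, so that a digraph can be reduced. If all
   in-neighbours of [x] are in-neighbours of [c], then [x] can be deleted and
   its weight moved to [c]; if [a], [b] are nonadjacent and no walk of length
   less than [k] leads from [b] to [a], then the edge from [a] to [b] can be
   added. In an irreducible counterexample of girth greater than [k], every edge
   is therefore on a cycle of length [k + 1].

   By the bound on the independence number, the non-neighbours of a vertex [v]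
   induce an acyclic digraph. An exit of [u] in [N+(v)] is an out-neighbour of
   [u] at distance [k - 1] to [v]. If a short walk but no edge leads from [u] to
   [x], both in [N+(v)], then the exits of [u] lead to those of [x] inside the
   non-neighbours of [v]. So some [u] in [N+(v)] reaches no other member of
   [N+(v)] by a short walk. This makes every out-ball of radius [k - 2] heavier
   than [(k - 2) d]. By averaging, the in-ball of radius [k - 2] around some [v]
   is as heavy; it is disjoint from [N+(v)] and from [N+(u)], where [u] is a
   sink of [N+(v)], so the total weight exceeds [k d]. *)

Set Implicit Arguments.
Unset Strict Implicit.
Unset Printing Implicit Defensive.

(* [lia] would otherwise case-split on every boolean hypothesis. *)
Ltac nat_lia :=
  repeat match goal with
  | H : is_true ?b |- _ =>
    lazymatch b with
    | leq _ _ => fail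
    | andb (leq _ _) (leq _ _) => fail
    | _ => clear H
    end
  end; lia.

(** * Walks and girth *)

Section Walks.
Variables (T : finType) (e : rel T).

Fixpoint walk (n : nat) (x y : T) : bool :=
  if n is m.+1 then [exists z, e x z && walk m z y] else x == y.

Lemma walkS n x y z : e x y -> walk n y z -> walk n.+1 x z.
Proof. by move=> xy yz; apply/existsP; exists y; rewrite xy. Qed.

Lemma walk_cat m n x y z : walk m x y -> walk n y z -> walk (m + n) x z.
Proof.
elim: m x => [|m IH] x; first by move/eqP->.
by case/existsP=> x' /andP[xx' x'y] yz; apply: walkS xx' (IH _ x'y yz).
Qed.

Lemma walk1 x y : walk 1 x y = e x y.
Proof.
apply/existsP/idP => [[z /andP[xz /eqP<-]] //|xy].
by exists y; rewrite xy /=.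
Qed.

Lemma walkSr n x y z : walk n x y -> e y z -> walk n.+1 x z.
Proof. by move=> xy yz; rewrite -addn1; apply: walk_cat xy _; rewrite walk1. Qed.

Lemma walk_fun n x y : walk n x y ->
  exists c : nat -> T,
    [/\ c 0 = x, c n = y & forall i, i < n -> e (c i) (c i.+1)].
Proof.
elim: n x => [|n IH] x /=; first by move/eqP<-; exists (fun=> x).
case/existsP=> z /andP[xz /IH[c [c0 cn ce]]].
exists (fun i => if i is j.+1 then c j else x); split=> //.
by case=> [|i] ilt; [rewrite c0 | apply: ce].
Qed.

Lemma fun_walk (c : nat -> T) n i j :
  (forall l, l < n -> e (c l) (c l.+1)) -> i <= j <= n ->
  walk (j - i) (c i) (c j).
Proof.
move=> ce; elim: j => [|j IH] /andP[ij jn].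
  by move: ij; rewrite leqn0 => /eqP->; rewrite /= eqxx.
move: ij; rewrite leq_eqVlt => /orP[/eqP->|ij]; first by rewrite subnn /= eqxx.
rewrite subSn; last by [].
by apply: walkSr (ce _ jn); apply: IH; rewrite -ltnS ij ltnW.
Qed.

(** Closed walks replace cycles, so that walks can be joined without checking distinctness; a
    shortest closed walk is a cycle. *)
Definition girth_gt (k : nat) : Prop :=
  forall n x, 0 < n <= k -> ~~ walk n x x.

Lemma girth_gt_walk k n x :
  girth_gt k -> walk n x x -> 0 < n -> k < n.
Proof.
move=> short w n0; rewrite ltnNge; apply/negP => nk.
by have := short n x; rewrite n0 nk w => /(_ isT).
Qed.

Lemma path_walk x p : path e x p -> walk (size p) x (last x p).
Proof.
elim: p x => [|y p IH] x /=; first by rewrite eqxx.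
by case/andP=> xy /IH; apply: walkS.
Qed.

(* A closed walk that is no longer than any other one is an induced cycle. *)
Lemma shortest_induced n (c : nat -> T) i j :
  girth_gt n.-1 -> (forall l, l < n -> e (c l) (c l.+1)) -> c n = c 0 ->
  i + 2 <= j -> j + 2 <= i + n -> j < n ->
  [/\ c i <> c j, ~~ e (c i) (c j) & ~~ e (c j) (c i)].
Proof.
move=> short ce cn ij jin jn.
have ijn : i <= j <= n by nat_lia.
have w := fun_walk ce ijn.
split.
- move=> eq_ij; rewrite -eq_ij in w.
  by have := girth_gt_walk short w; nat_lia.
(* The chord replaces the closed walk by one of length [i + 1 + (n - j) < n]. *)
- apply/negP => eij.
  have w1 : walk (n - j) (c j) (c 0) by rewrite -cn; apply: fun_walk ce _; nat_lia.
  have := fun_walk ce (_ : 0 <= i <= n); rewrite subn0 => /(_ ltac:(nat_lia)) w0.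
  have := girth_gt_walk short (walk_cat w0 (walkS eij w1)); nat_lia.
- apply/negP => eji.
  have := girth_gt_walk short (walkSr w eji); nat_lia.
Qed.

End Walks.

(** * Alternating vertices of a cycle *)

Section Alternating.
Variables (T : finType) (e : rel T) (k : nat).
Hypothesis small_indep :
  forall A : {set T}, independent e A -> 2 * #|A| <= k + 1.
Hypothesis loopless : forall x, ~~ e x x.

(* The number of the positions 2, 4, ... below [k]. *)
Definition half_below := k.-1./2.

(** Otherwise [z] and the values of [f] form an independent set of size [half_below + 2], and twice
    that is at least [k + 2]. *)
Lemma alternating_adj (f : nat -> T) z :
  (forall i j, i < j -> j <= half_below ->
     [/\ f i <> f j, ~~ e (f i) (f j) & ~~ e (f j) (f i)]) ->
  exists2 i, i <= half_below & [\/ z = f i, e z (f i) | e (f i) z].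
Proof.
move=> fP.
pose adj i := [|| z == f i, e z (f i) | e (f i) z].
case: (boolP [exists i : 'I_half_below.+1, adj i]) => [/existsP[i iP] | no].
  exists i; first by rewrite -ltnS ltn_ord.
  by case/or3P: iP => [/eqP|?|?]; constructor.
exfalso.
have nadj i : i <= half_below -> [/\ z <> f i, ~~ e z (f i) & ~~ e (f i) z].
  move=> ile; move/existsPn/(_ (inord i)): no; rewrite /adj inordK ?ltnS //.
  by rewrite !negb_or => /and3P[/eqP ? ? ?].
pose g (i : 'I_half_below.+1) := f i.
have g_inj : injective g.
  move=> i j; rewrite /g => eq_f; apply/val_inj => /=.
  by case: (ltngtP i j) => // lt; have [] := fP _ _ lt (_ : _ <= half_below);
     rewrite ?eq_f // -ltnS ltn_ord.
have zA : z \notin g @: setT.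
  by apply/imsetP => -[i _]; have [] := nadj i (_ : i <= half_below);
     rewrite // -ltnS ltn_ord.
have indA : independent e (z |: g @: setT).
  apply/forall_inP => x; rewrite in_setU1 => xA.
  apply/forall_inP => y; rewrite in_setU1 => yA.
  case/orP: xA => [/eqP->|/imsetP[i _ ->]];
  case/orP: yA => [/eqP->|/imsetP[j _ ->]].
  - exact: loopless.
  - by have [] := nadj j (_ : j <= half_below); rewrite // -ltnS ltn_ord.
  - by have [] := nadj i (_ : i <= half_below); rewrite // -ltnS ltn_ord.
  rewrite /g; case: (ltngtP i j) => [lt|lt|->]; last exact: loopless.
    by have [] := fP _ _ lt (_ : j <= half_below); rewrite // -ltnS ltn_ord.
  by have [] := fP _ _ lt (_ : i <= half_below); rewrite // -ltnS ltn_ord.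
have := small_indep indA.
rewrite cardsU1 zA card_imset // cardsT card_ord /half_below /=.
have := odd_double_half k.-1; nat_lia.
Qed.

End Alternating.
(** * Local structure around a vertex *)

Section Local.
Variables (T : finType) (e : rel T) (k : nat).
Hypothesis k_ge3 : 2 < k.
Hypothesis girth : girth_gt e k.
Hypothesis small_indep :
  forall A : {set T}, independent e A -> 2 * #|A| <= k + 1.

Lemma girth_lt n x : walk e n x x -> 0 < n -> k < n.
Proof. exact: girth_gt_walk girth. Qed.

Lemma girth_loopless x : ~~ e x x.
Proof. by apply/negP; rewrite -walk1 => /girth_lt; nat_lia. Qed.

Definition nonadjacent v z := [&& z != v, ~~ e v z & ~~ e z v].

Definition nonadjacent_edge v a b := [&& nonadjacent v a, nonadjacent v b & e a b].

(* The even vertices of a shortest cycle avoiding the neighbours of [v] would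
   form, together with [v], too large an independent set. *)
Lemma nonadjacent_acyclic v a b :
  a != b -> connect (nonadjacent_edge v) a b ->
  connect (nonadjacent_edge v) b a -> False.
Proof.
move=> ab /connectP[p pP lp] /connectP[q qP lq].
have closed : exists n, (0 < n) && [exists x, walk (nonadjacent_edge v) n x x].
  exists (size p + size q).
  have p_gt0 : 0 < size p by case: p lp {pP} => //= ab'; rewrite ab' eqxx in ab.
  rewrite addn_gt0 p_gt0; apply/existsP; exists a.
  have := path_walk pP; have := path_walk qP; rewrite -lp -lq => w1 w2.
  exact: walk_cat w2 w1.
case: (ex_minnP closed) => n /andP[n_gt0 /existsP[x w]] n_min.
have short : girth_gt (nonadjacent_edge v) n.-1.
  move=> m z /andP[m_gt0 mn]; apply/negP => wz.
  have /n_min : (0 < m) && [exists x, walk (nonadjacent_edge v) m x x].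
    by rewrite m_gt0; apply/existsP; exists z.
  by nat_lia.
case: (walk_fun w) => c [c0 cn ce].
have ee l : l < n -> e (c l) (c l.+1) by move/ce/and3P=> [].
have nonadj l : l < n -> nonadjacent v (c l) by move/ce/and3P=> [].
have kn : k < n.
  by have := fun_walk ee (_ : 0 <= n <= n); rewrite subn0 leqnn leq0n cn c0;
     move/(_ isT)/girth_lt; apply.
(* Since [k < n], even the last of these positions and position 0 are not consecutive on the
   cycle. *)
have hb : 2 * half_below k + 2 <= n.
  by rewrite /half_below; have := odd_double_half k.-1; rewrite -muln2; nat_lia.
have [|i ik E] := @alternating_adj _ _ _ small_indep girth_loopless
    (fun i => c (2 * i)) v.
  move=> i j ij jk.
  have [||||ne n1 n2] := @shortest_induced _ _ n c (2 * i) (2 * j) short ce.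
  - by rewrite cn c0.
  - nat_lia.
  - nat_lia.
  - nat_lia.
  have ni := nonadj (2 * i) ltac:(nat_lia).
  have nj := nonadj (2 * j) ltac:(nat_lia).
  by move: n1 n2; rewrite /nonadjacent_edge ni nj /=.
have /nonadj/and3P[ne n1 n2] : 2 * i < n by nat_lia.
by case: E => [E|E|E]; rewrite E ?eqxx in ne n1 n2.
Qed.

(** * Cycles of length [k + 1] through an edge, and exits *)

Section Exits.
Variables v u : T.
Hypothesis vu : e v u.

(** By the girth bound this is an induced cycle, and [c 2] is an exit of [u]. *)
Definition cycle_from_edge (c : nat -> T) : Prop :=
  [/\ c 0 = v, c 1 = u, c k.+1 = v & forall l, l < k.+1 -> e (c l) (c l.+1)].

Lemma cycle_from_edgeP y : e u y -> walk e k.-1 y v ->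
  exists2 c, cycle_from_edge c & c 2 = y.
Proof.
move=> uy /walk_fun[c [c0 ck ce]].
exists (fun i => if i is i'.+1 then if i' is j.+1 then c j else u else v).
  split=> //; first by case: k k_ge3 ck => [|k'].
  case=> [|[|l]] //= lk; first by rewrite c0.
  by apply: ce; nat_lia.
by [].
Qed.

Lemma cycle_segment c i j : cycle_from_edge c -> i <= j <= k.+1 ->
  walk e (j - i) (c i) (c j).
Proof. by case=> _ _ _ ce; apply: fun_walk ce. Qed.

Lemma cycle_induced c i j : cycle_from_edge c ->
  i + 2 <= j -> j <= i + k.-1 -> j <= k ->
  [/\ c i <> c j, ~~ e (c i) (c j) & ~~ e (c j) (c i)].
Proof.
case=> c0 _ ck ce ij jik jk.
by apply: (@shortest_induced _ _ k.+1) => //; [rewrite ck c0|nat_lia].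
Qed.

Lemma even_alternating c i j : cycle_from_edge c -> i < j -> j <= half_below k ->
  [/\ c (2 * i) <> c (2 * j), ~~ e (c (2 * i)) (c (2 * j))
    & ~~ e (c (2 * j)) (c (2 * i))].
Proof.
move=> cP ij; rewrite /half_below => jk.
have := odd_double_half k.-1; rewrite -muln2 => oh.
by apply: cycle_induced => //; nat_lia.
Qed.

Lemma odd_alternating c i j : cycle_from_edge c -> i < j -> j <= half_below k ->
  [/\ c (2 * i).+1 <> c (2 * j).+1, ~~ e (c (2 * i).+1) (c (2 * j).+1)
    & ~~ e (c (2 * j).+1) (c (2 * i).+1)].
Proof.
move=> cP ij; rewrite /half_below => jk.
have := odd_double_half k.-1; rewrite -muln2 => oh.
by apply: cycle_induced => //; nat_lia.
Qed.

Variables (x : T) (t : nat).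
Hypotheses (vx : e v x) (xu : x != u) (ux : ~~ e u x).
Hypotheses (w_ux : walk e t u x) (tk : t < k).

(** The edge to [c i] gives a closed walk of length [k + 3 - i] through [v] and [x], so [i <= 2]; an
    edge to [c 1 = u] would close the walk from [u] to [x]. *)
Lemma no_chord_from_head c i : cycle_from_edge c -> 0 < i <= k.+1 ->
  e x (c i) -> i = 2.
Proof.
move=> cP ik xi; have [c0 c1 ck ce] := cP.
have i2 : i <= 2.
  have w : walk e (k.+1 - i) (c i) v.
    by rewrite -ck; apply: cycle_segment => //; nat_lia.
  have := girth_lt (walkS vx (walkS xi w)); nat_lia.
case: i ik i2 xi => [|[|[|i]]] // _ _; rewrite c1
  => /(walkSr w_ux)/girth_lt; nat_lia.
Qed.

Lemma head_not_on_cycle c i : cycle_from_edge c -> i <= k -> x != c i.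
Proof.
move=> cP ik; have [c0 c1 ck ce] := cP.
have w : walk e (k.+1 - i) (c i) v.
  by rewrite -ck; apply: cycle_segment => //; nat_lia.
case: i ik w => [|[|i]] ik w; apply/eqP => E.
- by move: vx; rewrite E c0; apply/negP/girth_loopless.
- by move: xu; rewrite E c1 eqxx.
by rewrite -E in w; have := girth_lt (walkS vx w); nat_lia.
Qed.

(** Some odd position is adjacent to [x]. From [x] an edge can only lead to [c 2], an even position,
    so the edge leads into [x]. *)
Lemma cycle_to_head c : cycle_from_edge c -> exists2 j, 2 < j <= k & e (c j) x.
Proof.
move=> cP; have [c0 c1 ck ce] := cP.
have hb : 2 * half_below k < k.
  by rewrite /half_below; have := odd_double_half k.-1; rewrite -muln2; nat_lia.
have [i ik [E|E|E]] := @alternating_adj _ _ _ small_indep girth_loopless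
  (fun i => c (2 * i).+1) x (fun i j => odd_alternating cP).
- by have := @head_not_on_cycle c (2 * i).+1 cP ltac:(nat_lia); rewrite E eqxx.
- by have := no_chord_from_head cP (_ : 0 < (2 * i).+1 <= k.+1) E; nat_lia.
exists (2 * i).+1 => //; case: i ik E => [|i]; last by nat_lia.
by rewrite muln0 c1 (negPf ux).
Qed.

(** On a cycle with [c 2 = y], the edge from some [c j] into [x] would close a walk of length
    [j <= k]. *)
Lemma no_common_exit y : e u y -> e x y -> ~~ walk e k.-1 y v.
Proof.
move=> uy xy; apply/negP => wy.
have [c cP c2] := cycle_from_edgeP uy wy.
have [j jk jx] := cycle_to_head cP.
have w := @cycle_segment c 2 j cP ltac:(nat_lia).
by rewrite c2 in w; have := girth_lt (walkS jx (walkS xy w)); nat_lia.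
Qed.

(** Some even position is adjacent to [y]. If the edge leads into [y], the cycle carries [c 2] to
    [y] among the non-neighbours of [v]. Otherwise it leads to [c 2], and the odd positions then
    force the edge from [y] to [u]. *)
Lemma exits_ordered y c : cycle_from_edge c -> e x y -> walk e k.-1 y v ->
  c 2 != y /\ (connect (nonadjacent_edge v) (c 2) y \/
    [/\ e y (c 2), e (c k) x & e y u]).
Proof.
move=> cP xy wy; have [c0 c1 ck ce] := cP.
have hb : 2 * half_below k < k.
  by rewrite /half_below; have := odd_double_half k.-1; rewrite -muln2; nat_lia.
have uc2 : e u (c 2) by rewrite -c1; apply: ce; nat_lia.
have wc2 : walk e k.-1 (c 2) v.
  have -> : k.-1 = k.+1 - 2 by nat_lia.
  by rewrite -ck; apply: cycle_segment => //; nat_lia.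
have nxc2 : ~~ e x (c 2).
  by apply/negP => xc2; have := no_common_exit uc2 xc2; rewrite wc2.
have no_chord i : 0 < i <= k.+1 -> ~~ e x (c i).
  by move=> ik; apply/negP => xi; have E := no_chord_from_head cP ik xi;
     rewrite E (negPf nxc2) in xi.
have y_off i : 0 < i <= k.+1 -> y <> c i.
  by move=> /no_chord/negP xi E; rewrite E in xy.
have nyv : ~~ e y v.
  apply/negP; rewrite -walk1 => yv.
  by have := girth_lt (walkS vx (walkS xy yv)); nat_lia.
have nvy : ~~ e v y.
  by apply/negP => vy; have := girth_lt (walkS vy wy); nat_lia.
have yv : y != v.
  by apply/eqP => E; have := y_off k.+1; rewrite ck; apply => //; nat_lia.
have y_fwd i : 0 < i <= k.+1 -> e y (c i) -> i <= 3.
  move=> ik yi.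
  have w : walk e (k.+1 - i) (c i) v.
    by rewrite -ck; apply: cycle_segment => //; nat_lia.
  by have := girth_lt (walkS vx (walkS xy (walkS yi w))); nat_lia.
split.
  have /y_off ne2 : 0 < 2 <= k.+1 by nat_lia.
  by apply/eqP => /esym.
have [i ik [E|E|E]] := @alternating_adj _ _ _ small_indep girth_loopless
  (fun i => c (2 * i)) y (fun i j => even_alternating cP).
- case: i ik E => [|i] ik E; first by rewrite E c0 eqxx in yv.
  by have /y_off/(_ E) : 0 < 2 * i.+1 <= k.+1 by nat_lia.
- have i1 : i = 1.
    case: i ik E => [|i] ik E; first by rewrite c0 (negPf nyv) in E.
    by have := y_fwd (2 * i.+1) ltac:(nat_lia) E; nat_lia.
  rewrite {}i1 muln1 in ik E.
  right; have [j jk jx] := cycle_to_head cP.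
  (* The closed walk from [c j] through [x], [y] and [c 2] has length [j + 1]. *)
  have jE : j = k.
    have w := @cycle_segment c 2 j cP ltac:(nat_lia).
    by have := girth_lt (walkS jx (walkS xy (walkS E w))); nat_lia.
  rewrite {j}jE in jk jx; split => //.
  have [i1 i1k [F|F|F]] := @alternating_adj _ _ _ small_indep girth_loopless
    (fun i => c (2 * i).+1) y (fun i j => odd_alternating cP).
  + by have /y_off/(_ F) : 0 < (2 * i1).+1 <= k.+1 by nat_lia.
  + have := y_fwd (2 * i1).+1 ltac:(nat_lia) F.
    (* An edge from [y] to [c 3] would close a walk of length [k] through [c k] and [x]; only
       position 1 remains. *)
    case: i1 i1k F => [|[|i1]] i1k F; [by rewrite -c1| |by nat_lia] => _.
    have w := @cycle_segment c 3 k cP ltac:(nat_lia).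
    by have := girth_lt (walkS jx (walkS xy (walkS F w))); nat_lia.
  + case: i1 i1k F => [|i1] i1k F.
      by rewrite muln0 c1 in F; have := no_common_exit F xy; rewrite wy.
    have w := @cycle_segment c 2 (2 * i1.+1).+1 cP ltac:(nat_lia).
    by have := girth_lt (walkS F (walkS E w)); nat_lia.
case: i ik E => [|i] ik E; first by rewrite c0 (negPf nvy) in E.
left.
have c_off l : 2 <= l <= k.-1 -> nonadjacent v (c l).
  move=> lk; have [] := @cycle_induced c 0 l cP; try nat_lia.
  by rewrite c0 /nonadjacent => ne -> ->; rewrite eq_sym; case: eqP.
apply: (@connect_trans _ _ (c (2 * i.+1))); last first.
  apply: connect1; rewrite /nonadjacent_edge c_off ?E; last by nat_lia.
  by rewrite /nonadjacent yv nyv nvy.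
have conn l : 2 <= l <= k.-1 -> connect (nonadjacent_edge v) (c 2) (c l).
  elim: l => // l IH lk.
  case: (ltnP 1 l) => l1; last by have -> : l = 1 by nat_lia.
  apply: connect_trans (IH _) (connect1 _); first by nat_lia.
  by rewrite /nonadjacent_edge !c_off ?ce //; nat_lia.
by apply: conn; nat_lia.
Qed.

End Exits.

Definition within r x y := [exists i : 'I_r.+1, walk e i x y].

Lemma withinP r x y :
  reflect (exists2 i, i <= r & walk e i x y) (within r x y).
Proof.
apply: (iffP existsP) => [[i w]|[i ir w]]; last first.
  by exists (Ordinal (ir : i < r.+1)).
by exists i => //; rewrite -ltnS ltn_ord.
Qed.

(** * Sinks of an out-neighbourhood *)

Section Sink.
Variable v : T.
Hypothesis tight : forall u, e v u -> walk e k u v.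

(** By [tight], the default is never taken for an out-neighbour of [v]. *)
Definition exit u := odflt u [pick a | e u a && walk e k.-1 a v].

Lemma exitP u : e v u -> e u (exit u) /\ walk e k.-1 (exit u) v.
Proof.
move=> vu; rewrite /exit; case: pickP => [a /andP[] //|no].
have := tight vu; have -> : k = k.-1.+1 by nat_lia.
by case/existsP=> a wa; have := no a; rewrite wa.
Qed.

Definition precedes u x :=
  exit u != exit x /\ connect (nonadjacent_edge v) (exit u) (exit x).

(** The inclusion of the reachable sets is strict because acyclicity keeps [exit u] out of the
    smaller one. *)
Lemma precedes_rank u x : precedes u x ->
  #|connect (nonadjacent_edge v) (exit x)| <
  #|connect (nonadjacent_edge v) (exit u)|.
Proof.
case=> ne ux; apply/proper_card/properP; split.
  by apply/subsetP => z; apply: connect_trans.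
exists (exit u); first exact: connect0.
by apply/negP => xu; apply: nonadjacent_acyclic ne ux xu.
Qed.

(* A set without sinks could be shrunk to the out-neighbours of a member whose
   exit reaches fewest vertices. *)
Lemma exists_sink r : r < k ->
  (forall u x, e v u -> e v x -> x != u -> ~~ e u x ->
     within r u x \/ (exists w, [/\ e v w, e u w & within r w x]) ->
     precedes u x) ->
  (exists u, e v u) ->
  exists2 u, e v u & forall x, e v x -> x != u -> ~~ within r u x.
Proof.
move=> r_lt_k prec [u0 vu0].
pose next u x := [&& e v x, x != u & within r u x].
case: (boolP [exists u, e v u && [forall x, ~~ next u x]]).
  case/existsP=> u /andP[vu /forallP H]; exists u => // x vx xu.
  by have := H x; rewrite /next vx xu.
move=> no; exfalso.
have nextP u : e v u -> exists x, next u x.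
  move=> vu; move/existsPn/(_ u): no; rewrite vu /= => /forallPn[x].
  by rewrite negbK; exists x.
have shrink n (D : {set T}) : #|D| <= n -> D != set0 ->
    (forall u, u \in D -> e v u) ->
    (forall u, u \in D -> exists2 x, x \in D & next u x) -> False.
  elim: n D => [|n IH] D.
    by rewrite leqn0 cards_eq0 => ->.
  move=> Dn /set0Pn[u1 u1D] DN Dnext.
  pose rank u := #|connect (nonadjacent_edge v) (exit u)|.
  case: (arg_minnP rank u1D) => u uD u_min.
  have not_prec x : x \in D -> ~ precedes u x.
    by move=> xD /precedes_rank; rewrite ltnNge u_min.
  (* As [u] precedes no member of [D], any other member within [r] of [u], or of an out-neighbour of
     [u] in [D], is itself an out-neighbour of [u]. *)
  apply: (IH [set x in D | e u x]).
  - have : [set x in D | e u x] \proper D.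
      apply/properP; split; first by apply/subsetP => x; rewrite inE => /andP[].
      by exists u => //; rewrite inE negb_and girth_loopless orbT.
    by move/proper_card => H; rewrite -ltnS; apply: leq_trans H Dn.
  - have [x xD /and3P[vx xu wx]] := Dnext u uD.
    apply/set0Pn; exists x; rewrite inE xD /=; case: (boolP (e u x)) => // nux.
    by case: (not_prec x xD); apply: prec => //; [exact: DN | left].
  - by move=> x; rewrite inE => /andP[/DN].
  move=> x; rewrite inE => /andP[xD ux].
  have [x' x'D nxt] := Dnext x xD; exists x' => //; rewrite inE x'D /=.
  have /and3P[vx' x'x wx'] := nxt.
  case: (boolP (e u x')) => // nux'; case: (not_prec x' x'D).
  apply: prec => //; [exact: DN| |by right; exists x; split => //; apply: DN].
  apply/eqP => E; rewrite {}E in wx'; case/withinP: wx' => i ir w.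
  by have := girth_lt (walkS ux w); nat_lia.
apply: (shrink #|T| [set u | e v u]).
- exact: max_card.
- by apply/set0Pn; exists u0; rewrite inE.
- by move=> u; rewrite inE.
move=> u; rewrite inE => vu; have [x nx] := nextP u vu; exists x => //.
by rewrite inE; case/and3P: nx.
Qed.

End Sink.

(** The exceptional alternative of [exits_ordered] would close the walk from [u] to [x] with two
    more edges, at length at most [r + 3]. *)
Lemma exists_sink_long v r : r + 3 <= k ->
  (forall u, e v u -> walk e k u v) -> (exists u, e v u) ->
  exists2 u, e v u & forall x, e v x -> x != u -> ~~ within r u x.
Proof.
move=> rk tight; apply: exists_sink => // [|u x vu vx xu nux w]; first by nat_lia.
have [t tr wt] : exists2 t, t <= r.+1 & walk e t u x.
  case: w => [/withinP[t tr wt]|[z [vz uz /withinP[t tr wt]]]].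
    by exists t; first exact: leqW.
  by exists t.+1 => //; apply: walkS uz wt.
have [ua wa] := exitP tight vu; have [xb wb] := exitP tight vx.
have [c cP c2] := cycle_from_edgeP vu ua wa.
have tk : t < k by nat_lia.
have [ne [conn|[_ _ bu]]] := exits_ordered vu vx xu nux wt tk cP xb wb.
  by rewrite c2 in ne conn.
have := girth_lt (walkS xb (walkS bu wt)); nat_lia.
Qed.

(** * Excluded digons and triangles, and sinks for [k = 3] *)

Definition adjacent x y := [|| x == y, e x y | e y x].

Lemma no_digon x y : e x y -> ~~ e y x.
Proof.
move=> xy; apply/negP; rewrite -walk1 => yx.
by have := girth_lt (walkS xy yx); nat_lia.
Qed.

Lemma no_triangle x y z : e x y -> e y z -> ~~ e z x.
Proof.
move=> xy yz; apply/negP; rewrite -walk1 => zx.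
by have := girth_lt (walkS xy (walkS yz zx)); nat_lia.
Qed.

(** For [k = 3] independent sets have at most two vertices. As [adjacent] includes equality, its
    negation also gives distinctness. *)
Lemma adjacent_triple x y z :
  k = 3 -> ~~ adjacent x y -> ~~ adjacent y z -> adjacent x z.
Proof.
move=> k3; rewrite /adjacent !negb_or => /and3P[xy n1 n2] /and3P[yz n3 n4].
apply/negPn/negP; rewrite !negb_or => /and3P[xz n5 n6].
have ind : independent e [set x; y; z].
  apply/forall_inP => a aA; apply/forall_inP => b.
  by move: aA; rewrite !inE -!orbA => /or3P[] /eqP-> /or3P[] /eqP->;
     rewrite ?girth_loopless.
have := small_indep ind; rewrite k3 setUC cardsU1 !inE negb_or eq_sym xz eq_sym yz.
by rewrite cards2 xy.
Qed.

Ltac absurd_cycle := match goal with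
  | H : is_true (e ?a ?a) |- _ =>
    by move: H; rewrite (negPf (girth_loopless a))
  | H1 : is_true (e ?a ?b), H2 : is_true (e ?b ?a) |- _ =>
    by move: H2; rewrite (negPf (no_digon H1))
  | H1 : is_true (e ?a ?b), H2 : is_true (e ?b ?c), H3 : is_true (e ?c ?a) |- _ =>
    by move: H3; rewrite (negPf (no_triangle H1 H2))
  end.

Ltac split_adjacent := case/or3P=> [/eqP ?|?|?]; first subst; try absurd_cycle.

Ltac not_adjacent := apply/negP; split_adjacent.

(* For [k = 3] the girth does not exclude the edge [y -> u] closing the walk
   [u -> w -> x -> y]; the exit [z] of [w] does. *)
Lemma short_exits_ordered v u w x q1 q2 y y2 z z2 :
  k = 3 -> e v u -> e v w -> e v x -> e u w -> e w x -> ~~ adjacent x u ->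
  e u q1 -> e q1 q2 -> e q2 v -> e x y -> e y y2 -> e y2 v ->
  e w z -> e z z2 -> e z2 v -> e y q1 -> e q2 x -> ~~ e y u.
Proof.
move=> k3 vu vw vx uw wx nxu uq1 q12 q2v xy yy2 y2v wz zz2 z2v yq1 q2x.
apply/negP => yu; have triple a b c := @adjacent_triple a b c k3.
clear k3.
have n_wy : ~~ adjacent w y by not_adjacent.
have n_yq2 : ~~ adjacent y q2 by not_adjacent.
have q2w : e q2 w by move: (triple _ _ _ n_wy n_yq2); split_adjacent.
have n_zv : ~~ adjacent z v by not_adjacent.
have n_vy : ~~ adjacent v y by not_adjacent.
have n_vq1 : ~~ adjacent v q1 by not_adjacent.
have n_q2u : ~~ adjacent q2 u by not_adjacent.
(* This edge makes [z] and [q2] nonadjacent, which then yields the edge from [u] to [z]. *)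
have zq1 : e z q1.
  move: (triple _ _ _ n_zv n_vy); split_adjacent.
    by move: (triple _ _ _ n_zv n_vq1); split_adjacent.
  have n_z2w : ~~ adjacent z2 w by not_adjacent.
  have yz2 : e y z2 by move: (triple _ _ _ n_z2w n_wy); split_adjacent.
  have n_z2x : ~~ adjacent z2 x by not_adjacent.
  have z2u : e z2 u by move: (triple _ _ _ n_z2x nxu); split_adjacent.
  have n_xq1 : ~~ adjacent x q1 by not_adjacent.
  have z2q1 : e z2 q1 by move: (triple _ _ _ n_z2x n_xq1); split_adjacent.
  by move: (triple _ _ _ n_zv n_vq1); split_adjacent.
have n_zq2 : ~~ adjacent z q2 by not_adjacent.
have uz : e u z by move: (triple _ _ _ n_zq2 n_q2u); split_adjacent.
(* The edge from [z] to [y] closes a triangle with [u]; the opposite edge forces the triangle of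
   [u], [z] and [z2]. *)
move: (triple _ _ _ n_zv n_vy); split_adjacent.
have n_z2w : ~~ adjacent z2 w by not_adjacent.
have yz2 : e y z2 by move: (triple _ _ _ n_z2w n_wy); split_adjacent.
have n_z2x : ~~ adjacent z2 x by not_adjacent.
have z2u : e z2 u by move: (triple _ _ _ n_z2x nxu); split_adjacent.
absurd_cycle.
Qed.

(** For [k = 3], [exists_sink_long] only allows radius 0, but the final count needs radius 1. *)
Lemma exists_sink_short v : k = 3 ->
  (forall u, e v u -> walk e k u v) -> (exists u, e v u) ->
  exists2 u, e v u & forall x, e v x -> x != u -> ~~ within 1 u x.
Proof.
move=> k3 tight; apply: exists_sink => // [|u x vu vx xu nux]; first by nat_lia.
have within1 a b : within 1 a b -> a != b -> e a b.
  case/withinP=> -[|[|i]] // _; first by move/eqP->; rewrite eqxx.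
  by rewrite walk1.
case=> [/within1|[w [vw uw /within1 wx]]].
  by rewrite eq_sym xu => /(_ isT) ux; rewrite ux in nux.
have {}wx : e w x.
  by apply: wx; apply: contraNneq nux => <-.
have [uq1 wq1] := exitP tight vu; have [xy wy] := exitP tight vx.
have [wz wwz] := exitP tight vw.
have [c cP c2] := cycle_from_edgeP vu uq1 wq1.
have wux : walk e 2 u x by apply: walkS uw _; rewrite walk1.
have k2 : 2 < k by [].
have [ne [conn|[yq1 q2x yu]]] := exits_ordered vu vx xu nux wux k2 cP xy wy.
  by rewrite c2 in ne conn.
have [c0 c1 ck ce] := cP.
have two a : walk e k.-1 a v -> exists2 b, e a b & e b v.
  by rewrite k3 => /existsP[b /andP[ab bv]]; exists b; rewrite // -walk1.
have [y2 yy2 y2v] := two _ wy; have [z2 zz2 z2v] := two _ wwz.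
have q12 : e (c 2) (c 3) by apply: ce; rewrite k3.
have q2v : e (c 3) v by rewrite -ck k3; apply: ce; rewrite k3.
rewrite k3 in q2x.
have nxu : ~~ adjacent x u.
  by rewrite /adjacent !negb_or xu nux andbT; apply: no_triangle uw wx.
rewrite -c2 in uq1.
have := short_exits_ordered k3 vu vw vx uw wx nxu uq1 q12 q2v xy yy2 y2v wz zz2 z2v.
by rewrite yq1 q2x yu => /(_ isT isT).
Qed.

End Local.

(** * Counting *)

Section Averaging.
Variables (T : finType) (w : T -> nat) (R : rel T) (D : nat).
Hypothesis w_gt0 : forall x, 0 < w x.
Hypothesis out_weight : forall x, D <= \sum_(y | R x y) w y.

(** Double counting of the pairs in [R] with weight [w x * w y]. *)
Lemma exists_in_weight (x0 : T) : exists y, D <= \sum_(x | R x y) w x.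
Proof.
case: (boolP [exists y, D <= \sum_(x | R x y) w x]) => [/existsP //|].
move/existsPn=> small; exfalso.
have swap : \sum_x w x * (\sum_(y | R x y) w y) =
            \sum_y w y * (\sum_(x | R x y) w x).
  under eq_bigr do rewrite big_distrr /= big_mkcond.
  under [RHS]eq_bigr do rewrite big_distrr /= big_mkcond.
  rewrite exchange_big; apply: eq_bigr => y _; apply: eq_bigr => x _.
  by rewrite mulnC.
have low : \sum_x w x * D <= \sum_x w x * (\sum_(y | R x y) w y).
  by apply: leq_sum => x _; rewrite leq_mul2l out_weight orbT.
have high : \sum_y w y * (\sum_(x | R x y) w x) < \sum_y w y * D.
  rewrite (bigD1 x0) //= [ltnRHS](bigD1 x0) //= -addSn leq_add //.
    by rewrite ltn_pmul2l // ltnNge small.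
  by apply: leq_sum => y _; rewrite leq_mul2l ltnW ?orbT // ltnNge small.
by move: high; rewrite -swap ltnNge low.
Qed.

End Averaging.

Section Counting.
Variables (T : finType) (e : rel T) (k d : nat) (w : T -> nat).
Hypothesis girth : girth_gt e k.
Hypothesis small_indep :
  forall A : {set T}, independent e A -> 2 * #|A| <= k + 1.
Hypothesis w_gt0 : forall x, 0 < w x.
Hypothesis d_gt0 : 0 < d.
Hypothesis out_weight : forall x, d <= \sum_(y | e x y) w y.

Lemma exists_out v : exists u, e v u.
Proof.
apply/existsP; case: (boolP [exists u, e v u]) => // /existsPn no.
have := out_weight v; rewrite big_pred0; first by nat_lia.
by move=> u; apply/negbTE.
Qed.

Lemma sum_indicator (P : pred T) : \sum_(z | P z) w z = \sum_z P z * w z.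
Proof.
by rewrite big_mkcond; apply: eq_bigr => z _; case: (P z); rewrite ?mul1n.
Qed.

Lemma weight_indicator v : w v = \sum_z (z == v) * w z.
Proof. by rewrite -sum_indicator big_pred1_eq. Qed.

(** Induction through a sink [u] of the out-neighbourhood of [v]: the latter meets the ball of
    radius [r] around [u] only in [u]. The extra summand of the bound, [w u] for the ball around
    [u], pays for this overlap. *)
Lemma ball_weight r v : 2 < k -> (forall x y, e x y -> walk e k y x) ->
  r + 2 <= k -> r * d + w v <= \sum_(z | within e r v z) w z.
Proof.
move=> k_ge3 tight; elim: r v => [|r IH] v rk.
  by rewrite (bigD1 v) ?leq_addr //=; apply/withinP; exists 0 => //=.
have rk3 : r + 3 <= k by nat_lia.
have [u vu sink] :=
  exists_sink_long k_ge3 girth small_indep rk3 (tight v) (exists_out v).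
suff : w v + \sum_(z | e v z) w z + \sum_(z | within e r u z) w z <=
       \sum_(z | within e r.+1 v z) w z + w u.
  have := out_weight v; have := IH u ltac:(nat_lia); rewrite mulSn.
  move: (\sum_(z | e v z) w z) (\sum_(z | within e r u z) w z) => a b.
  by move: (\sum_(z | within e r.+1 v z) w z) => c; nat_lia.
have step z : within e r u z -> within e r.+1 v z.
  by case/withinP=> i ir uz; apply/withinP; exists i.+1 => //; apply: walkS vu uz.
have edge z : e v z -> within e r.+1 v z.
  by move=> vz; apply/withinP; exists 1; rewrite ?walk1.
have centre : within e r.+1 v v by apply/withinP; exists 0 => //=.
rewrite !sum_indicator (weight_indicator v) (weight_indicator u) -!big_split /=.
apply: leq_sum => z _; rewrite -!mulnDl leq_mul2r; apply/orP; right.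
have [->|zv] := eqVneq z v.
  rewrite (negPf (girth_loopless k_ge3 girth v)) centre.
  case: (boolP (within e r u v)) => [/withinP[i ir uv]|_]; last by case: eqP.
  by have := girth_lt girth (walkS vu uv); nat_lia.
rewrite add0n; have [->|zu] := eqVneq z u.
  by rewrite vu edge //; case: within.
case: (boolP (e v z)) => [vz|_]; last first.
  by case: (boolP (within e r u z)) => // /step ->.
by rewrite (negPf (sink z vz zu)) edge.
Qed.

Lemma total_weight_of_tight : 2 < k -> (forall x y, e x y -> walk e k y x) ->
  forall x0 : T, k * d < \sum_x w x.
Proof.
move=> k_ge3 tight x0.
(* The centre is left out: its weight, counted separately, makes the final bound strict. *)
pose R x y := within e (k - 2) x y && (x != y).
have R_weight x : (k - 2) * d <= \sum_(y | R x y) w y.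
  have := @ball_weight (k - 2) x k_ge3 tight ltac:(nat_lia).
  rewrite (bigD1 x) /=; last by apply/withinP; exists 0 => //=.
  rewrite addnC leq_add2l => /leq_trans; apply.
  by rewrite leq_eqVlt; apply/orP; left; apply/eqP; apply: eq_bigl => y;
     rewrite /R eq_sym.
have [v v_in] := exists_in_weight w_gt0 R_weight x0.
have [u vu sink] : exists2 u, e v u &
    forall x, e v x -> x != u -> ~~ within e 1 u x.
  have [k3|k3] := eqVneq k 3.
    exact: exists_sink_short (tight v) (exists_out v).
  have {}k3 : 3 < k by rewrite ltn_neqAle eq_sym k3.
  by apply: exists_sink_long (tight v) (exists_out v) => //; nat_lia.
suff : w v + \sum_(x | R x v) w x + \sum_(x | e v x) w x + \sum_(x | e u x) w x
       <= \sum_x w x.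
  have := out_weight v; have := out_weight u; have := w_gt0 v.
  have : k * d = (k - 2) * d + d + d.
    by rewrite -addnA addnn -mul2n -mulnDl subnK // ltnW.
  move: v_in; move: (\sum_(x | R x v) w x) (\sum_(x | e v x) w x) => a b.
  move: (\sum_(x | e u x) w x) (\sum_x w x) (k * d) ((k - 2) * d) => a' b' p q.
  by nat_lia.
rewrite !sum_indicator (weight_indicator v) -!big_split /=.
apply: leq_sum => z _; rewrite -!mulnDl leq_mul2r; apply/orP; right.
have vz_far : R z v -> ~~ e v z /\ ~~ e u z.
  case/andP=> /withinP[i ik zv] _; split; apply/negP => h.
    by have := girth_lt girth (walkS h zv); nat_lia.
  by have := girth_lt girth (walkS vu (walkS h zv)); nat_lia.
have uv_disj : e v z -> ~~ e u z.
  move=> vz; apply/negP => uz.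
  have zu : z != u.
    by apply: contraTneq uz => ->; apply: girth_loopless girth _.
  have : within e 1 u z by apply/withinP; exists 1; rewrite ?walk1.
  by rewrite (negPf (sink z vz zu)).
have [zE|zv] := eqVneq z v.
  rewrite zE /R eqxx andbF (negPf (girth_loopless k_ge3 girth v)).
  by rewrite (negPf (no_digon k_ge3 girth vu)).
case: (boolP (R z v)) => [/vz_far[/negPf-> /negPf->] //|_].
by case: (boolP (e v z)) => [/uv_disj/negPf->|_] //; case: (e u z).
Qed.

End Counting.
(** * Reduction *)

Lemma walk_morph (T T' : finType) (e : rel T) (e' : rel T') (f : T' -> T) n p q :
  (forall p q, e' p q -> e (f p) (f q)) ->
  walk e' n p q -> walk e n (f p) (f q).
Proof.
move=> fe; elim: n p => [|n IH] p /=; first by move/eqP->.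
by case/existsP=> z /andP[pz /IH zq]; apply: walkS (fe _ _ pz) zq.
Qed.

Lemma sum_subtype (T : finType) (S P : pred T) (F : T -> nat) :
  \sum_(p : {x | S x} | P (val p)) F (val p) = \sum_(x | S x && P x) F x.
Proof.
rewrite (reindex_omap (val : {x | S x} -> T) insub) /=.
  by apply: eq_bigl => p; rewrite (valP p) valK eqxx andbT.
by move=> x /andP[Sx _]; rewrite insubT.
Qed.

(** * Deleting a dominated vertex *)

Section Removal.
Variables (T : finType) (e : rel T) (w : T -> nat) (x c : T).
Hypotheses (xc : x != c) (dominated : forall u, e u x -> e u c).

Definition rest := {z | z != x}.

Definition rest_edge (p q : rest) := e (val p) (val q).

Definition moved_weight z := w z + (z == c) * w x.

Lemma sum_moved_weight (P : pred T) :
  \sum_(z | (z != x) && P z) moved_weight z =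
  \sum_(z | (z != x) && P z) w z + P c * w x.
Proof.
rewrite big_split /=; congr (_ + _).
case: (boolP (P c)) => Pc.
  rewrite (bigD1 c) /=; last by rewrite eq_sym xc.
  rewrite eqxx mul1n big1 ?addn0 // => z /andP[_ /negPf->].
  by rewrite mul0n.
rewrite mul0n big1 // => z /andP[_ Pz].
by have [E|_] := eqVneq z c; rewrite ?mul0n // -E Pz in Pc.
Qed.

(** A vertex that loses the out-neighbour [x] keeps [c], which has received the weight of [x]. *)
Lemma rest_out_weight p :
  \sum_(z | e (val p) z) w z <=
  \sum_(q : rest | rest_edge p q) moved_weight (val q).
Proof.
rewrite (sum_subtype (fun z => z != x) (e (val p))) sum_moved_weight.
rewrite (bigID (fun z => z != x)) /=.
under eq_bigl do rewrite andbC; rewrite leq_add2l.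
rewrite (eq_bigl (fun z => e (val p) x && (z == x))); last first.
  by move=> z; rewrite negbK; case: eqP => [->|]; rewrite ?andbF.
case: (boolP (e (val p) x)) => [/dominated->|_]; last by rewrite big_pred0.
by rewrite /= big_pred1_eq mul1n.
Qed.

Lemma rest_total_weight :
  \sum_(q : rest) moved_weight (val q) = \sum_z w z.
Proof.
rewrite (sum_subtype (fun z => z != x) predT) sum_moved_weight mul1n.
rewrite [RHS](bigD1 x) //= addnC; congr (_ + _).
by apply: eq_bigl => z; rewrite andbT.
Qed.

Lemma rest_indep k :
  (forall A : {set T}, independent e A -> 2 * #|A| <= k + 1) ->
  forall A : {set rest}, independent rest_edge A -> 2 * #|A| <= k + 1.
Proof.
move=> small A /forall_inP indA; rewrite -(card_imset _ val_inj).
apply: small; apply/forall_inP => _ /imsetP[p pA ->].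
apply/forall_inP => _ /imsetP[q qA ->].
by have /forall_inP := indA p pA; apply.
Qed.

Lemma card_rest : #|{: rest}| < #|T|.
Proof.
have -> : #|{: rest}| = #|predC1 x| by rewrite card_sig; apply: eq_card.
by rewrite cardC1 ltn_predL; apply/card_gt0P; exists x.
Qed.

End Removal.

(** * Adding an edge *)

Section Saturation.
Variables (T : finType) (e : rel T) (k : nat) (a b : T).
Hypotheses (girth : girth_gt e k) (far_ba : ~~ within e k.-1 b a).

Definition add_edge x y := e x y || (x == a) && (y == b).

(** Only the parts before the first and after the last use of the new edge are kept. For a closed
    walk they join into a walk from [b] to [a]. *)
Lemma walk_add_edge n x y : walk add_edge n x y ->
  walk e n x y \/
  exists i j, [/\ i + j < n, walk e i x a & walk e j b y].
Proof.
elim: n x => [|n IH] x /=; first by left.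
case/existsP=> z /andP[xz /IH zy]; case/orP: xz => [xz|/andP[/eqP-> /eqP zb]].
  case: zy => [zy|[i [j [ij za yb]]]]; first by left; apply: walkS xz zy.
  by right; exists i.+1, j; split=> //; apply: walkS xz za.
rewrite zb in zy; right; case: zy => [zy|[i [j [ij za yb]]]].
  by exists 0, n; split=> //=.
by exists 0, j; split=> //=; nat_lia.
Qed.

Lemma add_edge_girth : girth_gt add_edge k.
Proof.
move=> n x nk; apply/negP => /walk_add_edge[w|[i [j [ij xa bx]]]].
  by have := girth x nk; rewrite w.
case/negP: far_ba; apply/withinP; exists (j + i); last exact: walk_cat bx xa.
by nat_lia.
Qed.

End Saturation.

(** For [k = 2], averaging gives a vertex whose in-neighbourhood is also heavy; it is disjoint from
    the out-neighbourhood, and neither contains the vertex. *)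
Lemma weighted_bound_le2 k d (T : finType) (e : rel T) (w : T -> nat) (x0 : T) :
  0 < k <= 2 -> girth_gt e k -> (forall x, 0 < w x) ->
  (forall x, d <= \sum_(y | e x y) w y) -> k * d < \sum_x w x.
Proof.
move=> k12 girth w_gt0 out_weight.
have loopless x : ~~ e x x.
  by apply/negP; rewrite -walk1 => /(girth_gt_walk girth); nat_lia.
have [k1|k2] : k = 1 \/ k = 2 by nat_lia.
  rewrite k1 mul1n (leq_ltn_trans (out_weight x0)) //.
  rewrite [ltnRHS](bigID (e x0)) /= -[ltnLHS]addn0 ltn_add2l.
  by rewrite (bigD1 x0) ?loopless //= ltn_addr.
have digonless x y : e x y -> ~~ e y x.
  move=> xy; apply/negP; rewrite -walk1 => yx.
  by have := girth_gt_walk girth (walkS xy yx); nat_lia.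
have [v v_in] := exists_in_weight w_gt0 out_weight x0.
rewrite k2 mul2n -addnn (leq_ltn_trans (leq_add (out_weight v) v_in)) //.
rewrite [ltnRHS](bigID (e v)) /= -addnS leq_add2l.
rewrite [leqRHS](bigID (e^~ v)) /= -addn1 leq_add //.
  rewrite leq_eqVlt; apply/orP; left; apply/eqP; apply: eq_bigl => x.
  by case: (boolP (e x v)) => [/digonless->|]; rewrite ?andbF.
by rewrite (bigD1 v) ?loopless //= (leq_trans (w_gt0 v)) ?leq_addr.
Qed.

(** Nested induction: deleting a vertex lowers [n], adding an edge lowers [m]. *)
Lemma weighted_bound k d n m (T : finType) (e : rel T) (w : T -> nat) (x0 : T) :
  0 < k -> 0 < d -> #|T| <= n -> #|[set p : T * T | ~~ e p.1 p.2]| <= m ->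
  girth_gt e k ->
  (forall A : {set T}, independent e A -> 2 * #|A| <= k + 1) ->
  (forall x, 0 < w x) -> (forall x, d <= \sum_(y | e x y) w y) ->
  k * d < \sum_x w x.
Proof.
move=> k_gt0 d_gt0; case: (leqP k 2) => [k_le2|k_ge3].
  by move=> *; apply: (@weighted_bound_le2 _ _ _ e) => //; rewrite k_gt0.
elim: n m T e w x0 => [|n IHn] m T e w x0.
  by rewrite leqNgt; case/negP; apply/card_gt0P; exists x0.
elim: m e w => [|m IHm] e w Tn em girth small w_gt0 out_weight.
  move: em; rewrite leqNgt; case/negP; apply/card_gt0P; exists (x0, x0).
  by rewrite inE (girth_loopless k_ge3 girth).
case: (boolP [exists x, exists c, (x != c) && [forall u, e u x ==> e u c]]).
  case/existsP=> x /existsP[c /andP[xc /forallP dom]].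
  have {}dom u : e u x -> e u c by apply/implyP.
  rewrite -(rest_total_weight w xc).
  have cx : c != x by rewrite eq_sym.
  apply: (IHn _ _ (@rest_edge T e x) _ (exist _ c cx)).
  - by rewrite -ltnS; apply: leq_trans (card_rest x) Tn.
  - exact: leqnn.
  - move=> l p lk; apply: contra (girth l (val p) lk).
    exact: walk_morph.
  - exact: rest_indep.
  - by move=> p; rewrite /moved_weight ltn_addr.
  by move=> p; apply: leq_trans (out_weight _) (rest_out_weight _ xc dom p).
move=> irreducible.
pose addable (a b : T) := [&& ~~ e a b, ~~ e b a, a != b & ~~ within e k.-1 b a].
case: (boolP [exists a, exists b, addable a b]).
  case/existsP=> a /existsP[b /and4P[nab nba ab far_ba]].
  apply: (IHm (add_edge e a b)) => //.
  - rewrite -ltnS; apply: leq_trans em; apply: proper_card; apply/properP; split.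
      apply/subsetP => p; rewrite !inE; apply: contra => pe.
      by rewrite /add_edge pe.
    by exists (a, b); rewrite !inE //= negbK /add_edge !eqxx orbT.
  - exact: add_edge_girth.
  - move=> A /forall_inP indA; apply: small; apply/forall_inP => y yA.
    apply/forall_inP => z zA; have /forall_inP/(_ z zA) := indA y yA.
    by apply: contra => yz; rewrite /add_edge yz.
  move=> y; apply: leq_trans (out_weight y) _.
  rewrite big_mkcond [leqRHS]big_mkcond.
  by apply: leq_sum => z _; rewrite /add_edge; case: (e y z).
move=> saturated.
apply: (total_weight_of_tight girth small w_gt0 d_gt0 out_weight) => //.
move=> v c vc.
have vNc : v != c by apply: contraTneq vc => ->; apply: girth_loopless girth _.
(* Some in-neighbour [u] of [v] has no edge to [c]. By saturation a walk of length below [k] leads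
   from [c] to [u]; extended to [v], it has length exactly [k] by the girth bound. *)
move/existsPn/(_ v)/existsPn/(_ c): irreducible; rewrite vNc /= => /forallPn[u].
rewrite negb_imply => /andP[uv nuc].
have ncu : ~~ e c u.
  by apply/negP => cu; have := no_triangle k_ge3 girth vc cu; rewrite uv.
have uc : u != c.
  by apply: contraTneq uv => ->; apply: no_digon girth _ _ vc.
move/existsPn/(_ u)/existsPn/(_ c): saturated.
rewrite /addable nuc ncu uc /= negbK => /withinP[i ik cu].
have cv := walkSr cu uv.
have := girth_gt_walk girth (walkS vc cv) isT.
by move=> ki; have <- : i.+1 = k by nat_lia.
Qed.

(** * Unit weights, and the girth from a shortest closed walk *)

Theorem theorem2p3 (d k : nat) (hd : 1 <= d) (hk : 1 <= k)
    (V : finType) (e : rel V) (hV : 0 < #|V|) (he : simple_digraph e)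
    (hn : #|V| <= k * d) (hout : forall x : V, d <= outdeg e x)
    (halpha : 2 * alpha e <= k + 1) :
  girth_leq e k.
Proof.
have [x0 _] := card_gt0P hV.
have [n [x [n_gt0 nk wx]]] : exists n, exists x, [/\ 0 < n, n <= k & walk e n x x].
  case: (boolP [exists n : 'I_k.+1, exists x, (0 < n) && walk e n x x]).
    case/existsP=> n /existsP[x /andP[n_gt0 wx]].
    by exists n, x; split; rewrite // -ltnS ltn_ord.
  move=> no; exfalso.
  have girth : girth_gt e k.
    move=> n x /andP[n_gt0 nk]; apply/negP => w; case/negP: no.
    apply/existsP; exists (Ordinal (nk : n < k.+1)).
    by apply/existsP; exists x; rewrite n_gt0.
  have small (A : {set V}) : independent e A -> 2 * #|A| <= k + 1.
    move=> indA; apply: leq_trans halpha; rewrite leq_mul2l /=.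
    by rewrite /alpha; apply: (@leq_bigmax_cond _ (independent e) (fun S => #|S|)).
  have : k * d < \sum_(y : V) 1.
    apply: (weighted_bound x0 _ _ (leqnn _) (leqnn _) girth) => // y.
    by rewrite sum1dep_card; apply: hout.
  by rewrite sum1_card ltnNge hn.
have closed : exists n, (0 < n) && [exists x, walk e n x x].
  by exists n; rewrite n_gt0; apply/existsP; exists x.
case: (ex_minnP closed) => g /andP[g_gt0 /existsP[y wy]] g_min.
have short : girth_gt e g.-1.
  move=> l z /andP[l_gt0 lg]; apply/negP => wz.
  have : g <= l by apply: g_min; rewrite l_gt0; apply/existsP; exists z.
  by nat_lia.
exists g; last first.
  by apply: leq_trans nk; apply: g_min; rewrite n_gt0; apply/existsP; exists x.
split; last first.
  move=> c /andP[c_gt0 /andP[cyc _]]; apply: g_min; rewrite c_gt0.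
  case: c c_gt0 cyc => // z c _ cyc; apply/existsP; exists z.
  by have := path_walk cyc; rewrite last_rcons size_rcons.
have [c [c0 cg ce]] := walk_fun wy.
(* The last vertex [c g = c 0] is omitted, as the closing edge is implicit. *)
exists (mkseq c g); last by rewrite size_mkseq.
have cE i : i < g -> nth y (mkseq c g) i = c i by move=> ig; rewrite nth_mkseq.
rewrite /dicycle /ucycleb size_mkseq g_gt0 andTb; apply/andP; split; last first.
  apply/(uniqP y) => i j; rewrite !inE size_mkseq => ig jg; rewrite !cE // => cij.
  have distinct l l' : l < l' -> l' < g -> c l <> c l'.
    move=> ll' l'g E; have w := @fun_walk _ e c g l l' ce ltac:(nat_lia).
    by rewrite -E in w; have := girth_gt_walk short w; nat_lia.
  case: (ltngtP i j) => // lt; first by case: (distinct _ _ lt jg).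
  by case: (distinct _ _ lt ig).
case: g g_gt0 cg ce cE {g_min short wy} => // g _ cg ce cE.
rewrite (_ : mkseq c g.+1 = c 0 :: mkseq (c \o S) g); last first.
  by rewrite /mkseq /= -[1]addn0 iotaDl -map_comp.
rewrite /= (_ : rcons _ _ = mkseq (c \o S) g.+1); last first.
  by rewrite mkseqS /= cg c0.
apply/(pathP y) => i; rewrite size_mkseq => ig; rewrite nth_mkseq //=.
by case: i ig => [|i] ig /=; rewrite ?nth_mkseq ?ce //= ltnW.
Qed.
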